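(* Let $J=(-\epsilon,\epsilon)$ and let $\Phi:\mathbb{R}^{n-1}\times J\to\mathbb{R}^n$, $\Phi(x;t)=(y_1(x;t),\dots,y_n(x;t))$, be an orientation-preserving $C^2$ diffeomorphism onto a domain $\Omega\subset\mathbb{R}^n$. For $t\in J$ let $\Gamma_t:\mathbb{R}^{n-1}\to\mathbb{R}^n$ be the parametrized hypersurface $x\mapsto\Phi(x;t)$. Let \[ \mathbf{n}=(-1)^{n-1}\det\begin{bmatrix}\mathbf{e}_1 & \frac{\partial y_1}{\partial x_1} & \cdots & \frac{\partial y_1}{\partial x_{n-1}}\\ \vdots & \vdots & & \vdots\\ \mathbf{e}_n & \frac{\partial y_n}{\partial x_1} & \cdots & \frac{\partial y_n}{\partial x_{n-1}}\end{bmatrix} \] (the Hodge dual of $\partial\Phi/\partial x_1\wedge\cdots\wedge\partial\Phi/\partial x_{n-1}$), and set $\varphi=\det d\Phi/\|\mathbf{n}\|$ and $\mathbf{N}=\mathbf{n}/\|\mathbf{n}\|$. Orient each $\Gamma_t$ by $\mathbf{N}$, and for $p\in\Omega$ let $H(p)$ be the mean curvature at $p$ of the oriented hypersurface $\Gamma_t$ containing $p$. Let $s$ be the arc-length parameter (modulo an additive constant) along the integral curves of $\mathbf{N}$. Then there exists a critical-point-free harmonic function $U$ on $\Omega$ whose family of level sets is $\{\Gamma_t\}_{t\in J}$ if and only if $\frac{\partial\varphi}{\partial s}+(n-1)H\varphi$ is constant on each $\Gamma_t$, i.e. \[ \frac{\partial}{\partial x_i}\left(\frac{\partial\varphi}{\partial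 s}+(n-1)H\varphi\right)=0\quad\text{for } i=1,\dots,n-1. \]
   Context: $\det d\Phi$ is the Jacobian determinant of $\Phi$. Quantities are transported between $\mathbb{R}^{n-1}\times J$ and $\Omega$ via $\Phi$: for $q\in\mathbb{R}^{n-1}\times J$, $(H\varphi)(q)=H(\Phi(q))\varphi(q)$ and $\frac{\partial\varphi}{\partial s}(q)=\frac{d}{ds}\big|_{s=0}\varphi(\Phi^{-1}(\alpha(s)))$ where $\alpha$ is the unit-speed integral curve of $\mathbf{N}$ with $\alpha(0)=\Phi(q)$. Mean curvature convention: at $p$ on a hypersurface oriented by unit normal $\mathbf{N}$, for a unit tangent $\mathbf{v}$ the normal section (intersection with the plane through $p$ spanned by $\mathbf{v},\mathbf{N}(p)$) has signed curvature $\kappa_p(\mathbf{v})=\langle c''(0),\mathbf{N}(p)\rangle$ for its unit-speed parametrization $c$ with $c(0)=p$, $c'(0)=\mathbf{v}$; $H(p)$ is the average of $\kappa_p(\mathbf{v})$ over unit tangent vectors $\mathbf{v}$ (i.e. $\frac1{n-1}$ times the sum of principal curvatures). *)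

(* Defs.v *)
From HB Require Import structures.
From mathcomp Require Import all_boot all_order all_algebra.
From mathcomp Require Import all_classical all_reals all_analysis.
Set Implicit Arguments. Unset Strict Implicit. Unset Printing Implicit Defensive.
Import Order.TTheory GRing.Theory Num.Theory.
Import numFieldNormedType.Exports.
Local Open Scope classical_set_scope.
Local Open Scope ring_scope.

(* Coordinates: n = m.+1.  A point q : 'rV[R]_m.+1 of R^{n-1} x J has
   x-coordinates q 0 (lift ord_max j), j : 'I_m, and t-coordinate q 0 ord_max. *)

Definition pd {R : realType} {k : nat} {V : normedModType R}
  (f : 'rV[R]_k -> V) (i : 'I_k) : 'rV[R]_k -> V :=
  fun x => derive f x (delta_mx 0 i).

Definition C2on {R : realType} {k : nat} {V : normedModType R}
  (D : set 'rV[R]_k) (f : 'rV[R]_k -> V) : Prop :=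
  (forall x, D x -> differentiable f x) /\
  (forall i x, D x -> differentiable (pd f i) x) /\
  (forall i j, {within D, continuous (pd (pd f i) j)}).

Definition Dom {R : realType} {m : nat} (eps : R) : set 'rV[R]_m.+1 :=
  [set q | `|q 0 ord_max| < eps].

Definition Gam {R : realType} {m : nat} (eps : R)
  (Phi : 'rV[R]_m.+1 -> 'rV[R]_m.+1) (t : R) : set 'rV[R]_m.+1 :=
  [set Phi q | q in [set q | Dom eps q /\ q 0 ord_max = t]].

Definition dotv {R : realType} {k : nat} (u v : 'rV[R]_k) : R :=
  \sum_(i < k) u 0 i * v 0 i.
Definition enorm {R : realType} {k : nat} (u : 'rV[R]_k) : R :=
  Num.sqrt (dotv u u).

Definition jac {R : realType} {m : nat} (Phi : 'rV[R]_m.+1 -> 'rV[R]_m.+1)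
  (q : 'rV[R]_m.+1) : 'M[R]_m.+1 :=
  \matrix_(i, j) (pd Phi j q) 0 i.

Definition xjac {R : realType} {m : nat} (Phi : 'rV[R]_m.+1 -> 'rV[R]_m.+1)
  (q : 'rV[R]_m.+1) : 'M[R]_(m.+1, m) :=
  \matrix_(i, j) (pd Phi (lift ord_max j) q) 0 i.

(* n = (-1)^{n-1} det [e | dy/dx], computed by cofactor expansion along the
   first column: the coefficient of e_k (0-based k) is
   (-1)^{n-1} (-1)^k det(dy/dx with row k removed). *)
Definition nvec {R : realType} {m : nat} (Phi : 'rV[R]_m.+1 -> 'rV[R]_m.+1)
  (q : 'rV[R]_m.+1) : 'rV[R]_m.+1 :=
  \row_k ((-1) ^+ m * (-1) ^+ k * \det (row' k (xjac Phi q))).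

Definition Nvec {R : realType} {m : nat} (Phi : 'rV[R]_m.+1 -> 'rV[R]_m.+1)
  (q : 'rV[R]_m.+1) : 'rV[R]_m.+1 :=
  (enorm (nvec Phi q))^-1 *: nvec Phi q.

Definition vphi {R : realType} {m : nat} (Phi : 'rV[R]_m.+1 -> 'rV[R]_m.+1)
  (q : 'rV[R]_m.+1) : R :=
  \det (jac Phi q) / enorm (nvec Phi q).

Definition ffund {R : realType} {m : nat} (Phi : 'rV[R]_m.+1 -> 'rV[R]_m.+1)
  (q : 'rV[R]_m.+1) : 'M[R]_m :=
  \matrix_(i, j) dotv (pd Phi (lift ord_max i) q) (pd Phi (lift ord_max j) q).
Definition sfund {R : realType} {m : nat} (Phi : 'rV[R]_m.+1 -> 'rV[R]_m.+1)
  (q : 'rV[R]_m.+1) : 'M[R]_m :=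
  \matrix_(i, j) dotv (pd (pd Phi (lift ord_max i)) (lift ord_max j) q) (Nvec Phi q).

(* mean curvature H(Phi q) of Gamma_t at Phi q: 1/(n-1) times the sum of the
   principal curvatures = 1/(n-1) * trace of the shape operator g^{-1} II *)
Definition meanH {R : realType} {m : nat} (Phi : 'rV[R]_m.+1 -> 'rV[R]_m.+1)
  (q : 'rV[R]_m.+1) : R :=
  (m%:R)^-1 * \tr (invmx (ffund Phi q) *m sfund Phi q).

(* d varphi / ds at q: derivative of varphi o Phi^{-1} along the unit field N
   at Phi q (Psi = Phi^{-1}) *)
Definition dphi_ds {R : realType} {m : nat}
  (Phi Psi : 'rV[R]_m.+1 -> 'rV[R]_m.+1) (q : 'rV[R]_m.+1) : R :=
  derive (fun p => vphi Phi (Psi p)) (Phi q) (Nvec Phi q).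

Definition Kq {R : realType} {m : nat}
  (Phi Psi : 'rV[R]_m.+1 -> 'rV[R]_m.+1) (q : 'rV[R]_m.+1) : R :=
  dphi_ds Phi Psi q + m%:R * meanH Phi q * vphi Phi q.

(* Main.v *)
(** The last coordinate T of Psi has the Gamma_t as level sets, and inverting the
    Jacobian matrix gives grad T = n / det dPhi, so phi = 1 / |grad T| and
    N = grad T / |grad T|.  Differentiating the tangency relations
    <grad T, d_i Phi> = 0 turns the trace of the shape operator into
    - phi (lap T - N (Hess T) N^T), and the derivative of phi along N is
    - phi^2 N (Hess T) N^T; hence phi_s + (n-1) H phi = - lap T / |grad T|^2.
    For U = c o T one has lap U = |grad T|^2 (c'' - c' K), where K is that
    quantity: a harmonic U without critical points forces K = c''/c', a function
    of t, and conversely c is recovered from K(t) by two integrations. *)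

Require Import Defs.
From HB Require Import structures.
From mathcomp Require Import all_boot all_order all_algebra.
From mathcomp Require Import ring.
From mathcomp Require Import all_classical all_reals all_analysis.
Import Order.TTheory GRing.Theory Num.Theory.
Import numFieldNormedType.Exports.
Local Open Scope classical_set_scope.
Local Open Scope ring_scope.
Set Implicit Arguments.
Unset Strict Implicit.
Unset Printing Implicit Defensive.

(** * Locality of derivatives, partial derivatives and the chain rule *)

Lemma near_open {T : topologicalType} {A : set T} {P : T -> Prop} {x : T} :
  open A -> A x -> (forall y, A y -> P y) -> \near x, P x.
Proof.
by move=> oA Ax AP; near=> y; apply: AP; near: y; exact: open_nbhs_nbhs.
Unshelve. all: by end_near. Qed.

(** The first-order expansion of [f] at [x] passes to [g] along the equality of germs, and
    uniqueness of the differential identifies its linear part. *)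
Lemma near_eq_differentiable {R : realType} {V W : normedModType R}
    (f g : V -> W) (x : V) :
  (\near x, f x = g x) -> differentiable f x -> differentiable g x.
Proof.
move=> fg df; have [cdf fE] := (diff_locallyP _ _).1 df.
have gE : g \o shift x = cst (g x) + 'd f x +o_ (0 : V) id.
  apply/eqaddoP => e e0; have /eqaddoP/(_ e e0) := fE.
  have fgx := nbhs_singleton fg.
  apply: filterS2 ((nbhs0P (fun y => f y = g y) x).1 fg) => y /= fgy.
  by rewrite !fctE /= fgx [y + x]addrC fgy.
have gd := diff_unique cdf gE.
by apply/diff_locallyP; rewrite gd.
Qed.

Lemma derive_pd {R : realType} {k : nat} {V : normedModType R}
    (f : 'rV[R]_k -> V) (x v : 'rV[R]_k) :
  differentiable f x -> 'D_v f x = \sum_i v 0 i *: pd f i x.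
Proof.
move=> df; rewrite deriveE// {1}(row_sum_delta v) linear_sum.
by apply: eq_bigr => i _; rewrite linearZ /pd deriveE.
Qed.

Lemma pd_coord {R : realType} {k n : nat} (f : 'rV[R]_k -> 'rV[R]_n)
    (j : 'I_k) (i : 'I_n) (x : 'rV[R]_k) :
  differentiable f x -> pd (fun y => f y 0 i) j x = pd f j x 0 i.
Proof. by move=> df; rewrite /pd derive_mx ?mxE//; exact: diff_derivable. Qed.

Lemma differentiable_coordE {R : realType} {V : normedModType R} {n : nat}
    (f : V -> 'rV[R]_n) (i : 'I_n) (x : V) :
  differentiable f x -> differentiable (fun y => f y 0 i) x.
Proof.
move=> df; apply: (@differentiable_comp _ _ _ _ f (fun M : 'rV[R]_n => M 0 i)) => //.
exact: differentiable_coord.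
Qed.

Lemma pd_comp {R : realType} {k n : nat} {V : normedModType R}
    (f : 'rV[R]_k -> 'rV[R]_n) (g : 'rV[R]_n -> V) (j : 'I_k) (x : 'rV[R]_k) :
  differentiable f x -> differentiable g (f x) ->
  pd (g \o f) j x = \sum_i pd f j x 0 i *: pd g i (f x).
Proof.
move=> df dg; have dgf : differentiable (g \o f) x by exact: differentiable_comp.
rewrite {1}/pd (deriveE _ dgf) diff_comp//= -(deriveE _ df).
by rewrite -(deriveE _ dg) (derive_pd _ dg).
Qed.

Lemma derive_comp1 {R : realType} {V : normedModType R}
    (f : V -> R) (g : R -> R) (x v : V) :
  differentiable f x -> derivable g (f x) 1 ->
  'D_v (g \o f) x = 'D_1 g (f x) * 'D_v f x.
Proof.
move=> df dg; have dg' : differentiable g (f x) by exact/derivable1_diffP.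
have dgf : differentiable (g \o f) x by exact: differentiable_comp.
rewrite (deriveE _ dgf) diff_comp//= deriv1E//.
by rewrite derive1E -(deriveE _ df) mulrC.
Qed.

(** * Primitives of continuous functions on an open symmetric interval *)

Lemma open_lt_norm {R : realType} (r : R) : open [set x : R | `|x| < r].
Proof.
have -> : [set x : R | `|x| < r] = ball 0 r.
  by apply/seteqP; split => x /=; rewrite -ball_normE /= sub0r normrN.
exact: ball_open.
Qed.

Lemma near_lt_norm {R : realType} (r x : R) : `|x| < r -> \near x, `|x| < r.
Proof.
by move=> xr; apply: open_nbhs_nbhs; split; [exact: open_lt_norm|exact: xr].
Qed.

(** The difference has derivative 0, so the mean value theorem on the segment between 0 and [x]
    makes it constant. This uniqueness is what allows local primitives to be glued. *)
Lemma eq_primitive {R : realType} (r : R) (F G f : R -> R) :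
  (forall x, `|x| < r -> is_derive (x : R) 1 F (f x)) ->
  (forall x, `|x| < r -> is_derive (x : R) 1 G (f x)) ->
  F 0 = G 0 -> forall x, `|x| < r -> F x = G x.
Proof.
move=> dF dG FG0 x xr.
have H0 y : `|y| <= `|x| -> is_derive (y : R) 1 (F - G) 0.
  move=> /le_lt_trans/(_ xr) yr; rewrite -(subrr (f y)).
  by apply: is_deriveB; [exact: dF|exact: dG].
have cH (a b : R) : (forall y, y \in `[a, b] -> `|y| <= `|x|) ->
    {within `[a, b], continuous (F - G)}.
  move=> ab; apply: derivable_within_continuous => y /ab/H0 dH.
  exact: ex_derive.
suff : (F - G) x = (F - G) 0.
  by rewrite !fctE FG0 subrr => /subr0_eq.
have [x0|x0] := leP 0 x.
- have ab y : y \in `[0, x] -> `|y| <= `|x|.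
    by rewrite in_itv/= => /andP[y0 yx]; rewrite !ger0_norm.
  have [||c _] := @MVT_segment _ (F - G) (cst 0) 0 x x0.
  + by move=> y /subset_itv_oo_cc /ab; exact: H0.
  + exact: cH.
  + by rewrite mul0r => /subr0_eq.
- have ab y : y \in `[x, 0] -> `|y| <= `|x|.
    rewrite in_itv/= => /andP[y0 yx].
    by rewrite !ler0_norm// ?lerN2// ltW.
  have [||c _] := @MVT_segment _ (F - G) (cst 0) x 0 (ltW x0).
  + by move=> y /subset_itv_oo_cc /ab; exact: H0.
  + exact: cH.
  + by rewrite mul0r => /subr0_eq ->.
Qed.

(** Continuity up to the endpoints makes [f] integrable, so the fundamental theorem of calculus
    applies; subtracting [G 0] gives the common normalization used for gluing. *)
Lemma compact_primitive {R : realType} (r : R) (f : R -> R) :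
  (forall x, `|x| <= r -> {for x, continuous f}) ->
  exists F : R -> R, F 0 = 0 /\ forall x, `|x| < r -> is_derive (x : R) 1 F (f x).
Proof.
move=> cf; pose G x := (\int[lebesgue_measure]_(t in `[-r, x]) f t)%R.
exists (fun x => G x - G 0); split; first by rewrite subrr.
move=> x xr.
have cfr : {within `[-r, r], continuous f}.
  apply: continuous_in_subspaceT => y; rewrite inE/= in_itv/= => yr.
  by apply: cf; rewrite ler_norml.
have intf : lebesgue_measure.-integrable `[-r, r] (EFin \o f).
  apply: continuous_compact_integrable; last exact: cfr.
  exact: segment_compact.
move: (xr); rewrite ltr_norml => /andP[rx xr'].
have [dG GE] : derivable G x 1 /\ G^`()%classic x = f x.
  apply: (continuous_FTC1_closed xr' intf rx).
  by apply: cf; rewrite ltW.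
have -> : (fun x => G x - G 0) = G - cst (G 0) by [].
rewrite -[X in is_derive _ _ _ X]subr0; apply: is_deriveB.
by rewrite -GE derive1E; exact: derivableP.
Qed.

(* [f] may be unbounded near [-r] and [r], so primitives on the intervals
   [-s, s] with [s < r], normalized at 0, are glued together. *)
Lemma open_primitive {R : realType} (r : R) (f : R -> R) :
  (forall x, `|x| < r -> {for x, continuous f}) ->
  exists F : R -> R, forall x, `|x| < r -> is_derive (x : R) 1 F (f x).
Proof.
move=> cf.
have /choice[F FP] : forall s : R, exists F : R -> R, s < r ->
    F 0 = 0 /\ forall x, `|x| < s -> is_derive (x : R) 1 F (f x).
  (* For [s >= r] nothing is claimed and [id] is a dummy value that makes the choice total. *)
  move=> s; have [sr|_] := ltP s r; last by exists id.
  have [x xs|F FP] := @compact_primitive _ s f; last by exists F.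
  by apply: cf; exact: le_lt_trans sr.
(* The midpoint of [|x|] and [r] is a radius that contains [x] strictly and stays below [r]. *)
pose s (x : R) := (`|x| + r) / 2.
have sE x : `|x| < r -> `|x| < s x /\ s x < r.
  by move=> xr; split; [exact: (midf_lt xr).1|exact: (midf_lt xr).2].
exists (fun x => F (s x) x) => x xr.
have [xs sr] := sE _ xr.
apply: near_eq_is_derive ((FP _ sr).2 _ xs).
near=> y.
have ys : `|y| < s x by near: y; exact: near_lt_norm.
have [ys' sr'] := sE _ (lt_trans ys sr).
have [F0 dF] := FP _ sr; have [F0' dF'] := FP _ sr'.
(* The primitives chosen for [x] and for [y] agree at [y], which lies in the smaller of their two
   intervals. *)
apply: (@eq_primitive _ (Num.min (s x) (s y)) _ _ f); last by rewrite lt_min ys.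
- by move=> z; rewrite lt_min => /andP[zx _]; exact: dF.
- by move=> z; rewrite lt_min => /andP[_ zy]; exact: dF'.
- by rewrite F0 F0'.
Unshelve. all: by end_near. Qed.

(** * Linear algebra: cofactors and the trace of a compressed bilinear form *)

Lemma sum_mulmx_minors {F : comPzRingType} {n m : nat}
    (J : 'M[F]_(n, m.+1)) (A : 'M[F]_(m.+1, n)) (i : 'I_m.+1) :
  col' i J *m row' i A + col i J *m row i A = J *m A.
Proof.
apply/matrixP => a b; rewrite !mxE big_ord1 !mxE [RHS](bigD1_ord i)//= addrC.
by congr (_ + _); apply: eq_bigr => k _; rewrite !mxE.
Qed.

(** With [A] inverse to [J], the adjugate is [\det J] times [A]; this converts the cofactors
    defining [nvec] into a row of the inverse Jacobian. *)
Lemma row_adj {F : comUnitRingType} {m : nat} (J A : 'M[F]_m) (i : 'I_m) :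
  A *m J = 1%:M -> \row_k cofactor J k i = \det J *: row i A.
Proof.
move=> AJ; have -> : \row_k cofactor J k i = row i (\adj J).
  by apply/rowP => k; rewrite !mxE.
suff -> : \adj J = \det J *: A by apply/rowP => k; rewrite !mxE.
by rewrite -[LHS]mul1mx -AJ -mulmxA mul_mx_adj mul_mx_scalar.
Qed.

(* [X (X^T X)^-1 X^T] is the orthogonal projection [1 - N^T N] onto the column
   space of [X]. *)
Lemma trace_compression {F : fieldType} {m : nat} (J A D : 'M[F]_m.+1)
    (N : 'rV[F]_m.+1) (c : F) (i : 'I_m.+1) (X := col' i J) :
  A *m J = 1%:M -> N = c *: row i A -> N *m N^T = 1%:M ->
  \tr (invmx (X^T *m X) *m (X^T *m D *m X)) = \tr D - (N *m D *m N^T) 0 0.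
Proof.
move=> AJ NE NN; have JA := mulmx1C AJ.
(* Splitting [A J = 1] by rows shows that [L] is a left inverse of [X] and that [G] annihilates
   [X]. *)
pose L := row' i A; pose t := col i J; pose G := row i A.
have XL : X *m L = 1%:M - t *m G.
  by rewrite -JA -(sum_mulmx_minors J A i) addrK.
have LX : L *m X = 1%:M.
  apply/matrixP => a b; transitivity ((A *m J) (lift i a) (lift i b)).
    by rewrite !mxE; apply: eq_bigr => k _; rewrite !mxE.
  by rewrite AJ !mxE (inj_eq lift_inj).
have GX : G *m X = 0.
  apply/matrixP => a b; transitivity ((A *m J) i (lift i b)).
    by rewrite !mxE; apply: eq_bigr => k _; rewrite !mxE.
  by rewrite AJ !mxE (negbTE (neq_lift _ _)).
have NX : N *m X = 0 by rewrite NE -scalemxAl GX scaler0.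
have c0 : c != 0.
  apply/eqP => c0; move: NN; rewrite NE c0 scale0r mul0mx => /matrixP/(_ 0 0).
  by rewrite !mxE => /eqP; rewrite eq_sym oner_eq0.
pose Q := 1%:M - N^T *m N.
have QT : Q^T = Q by rewrite /Q linearB/= trmx1 trmx_mul trmxK.
have GQ : G *m Q = 0.
  apply: (scalerI c0); rewrite scaler0 scalemxAl -NE.
  by rewrite mulmxBr mulmx1 mulmxA NN mul1mx subrr.
have QX : Q *m X = X by rewrite mulmxBl mul1mx -mulmxA NX mulmx0 subr0.
have XTQ : X^T *m Q = X^T by rewrite -{1}QT -trmx_mul QX.
have XLQ : X *m L *m Q = Q by rewrite XL mulmxBl mul1mx -mulmxA GQ mulmx0 subr0.
(* This is an explicit inverse of the Gram matrix: [X L] fixes the range of [Q], and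
   [X^T Q = X^T]. *)
pose g := L *m Q *m L^T.
have gI : X^T *m X *m g = 1%:M.
  rewrite -mulmxA (mulmxA X) (mulmxA X L) XLQ mulmxA XTQ -trmx_mul LX.
  exact: trmx1.
have -> : invmx (X^T *m X) = g.
  have [u _] := mulmx1_unit gI.
  by rewrite -[RHS]mul1mx -(mulVmx u) -[RHS]mulmxA gI mulmx1.
have XgX : X *m g *m X^T = Q.
  rewrite (mulmxA X) (mulmxA X L) XLQ -mulmxA -trmx_mul -{1}QT.
  by rewrite -trmx_mul XLQ QT.
(* Cyclicity of the trace brings together [X g X^T], which is the projection [Q]. *)
rewrite (mulmxA g) mxtrace_mulC (mulmxA X) (mulmxA (X *m g)) XgX mulmxBl mul1mx linearB/=.
by congr (_ - _); rewrite -(mulmxA N^T) mxtrace_mulC trace_mx11.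
Qed.

(** * Gradient, Hessian, inner product, and continuity of coordinates and sums *)

Definition grad {R : realType} {n : nat} (f : 'rV[R]_n -> R) (p : 'rV[R]_n) : 'rV[R]_n :=
  \row_i pd f i p.

Definition hess {R : realType} {n : nat} (f : 'rV[R]_n -> R) (p : 'rV[R]_n) : 'M[R]_n :=
  \matrix_(k, l) pd (pd f k) l p.

Lemma dotvE {R : realType} {n : nat} (u v : 'rV[R]_n) : u *m v^T = (dotv u v)%:M.
Proof.
apply/rowP => i; rewrite !mxE !ord1 eqxx mulr1n.
by apply: eq_bigr => k _; rewrite !mxE.
Qed.

Lemma dotvZl {R : realType} {n : nat} (c : R) (u v : 'rV[R]_n) :
  dotv (c *: u) v = c * dotv u v.
Proof. by rewrite /dotv mulr_sumr; apply: eq_bigr => k _; rewrite mxE mulrA. Qed.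

Lemma dotvC {R : realType} {n : nat} (u v : 'rV[R]_n) : dotv u v = dotv v u.
Proof. by apply: eq_bigr => k _; rewrite mulrC. Qed.

Lemma dotv_ge0 {R : realType} {n : nat} (u : 'rV[R]_n) : 0 <= dotv u u.
Proof. by apply: sumr_ge0 => k _; rewrite -expr2 sqr_ge0. Qed.

Lemma dotv_gt0 {R : realType} {n : nat} (u : 'rV[R]_n) : u != 0 -> 0 < dotv u u.
Proof.
move=> u0; rewrite lt_def dotv_ge0 andbT; apply: contra u0 => /eqP u0.
apply/eqP/rowP => k; rewrite mxE.
have sq_ge0 (i : 'I_n) : true -> 0 <= u 0 i * u 0 i by rewrite -expr2 sqr_ge0.
by have /eqP := @psumr_eq0P _ _ _ _ sq_ge0 u0 k isT; rewrite mulf_eq0 orbb => /eqP.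
Qed.

Lemma enormZ {R : realType} {n : nat} (c : R) (u : 'rV[R]_n) :
  0 <= c -> enorm (c *: u) = c * enorm u.
Proof.
move=> c0; rewrite /enorm dotvZl dotvC dotvZl mulrA -expr2 sqrtrM ?sqr_ge0//.
by rewrite sqrtr_sqr ger0_norm.
Qed.

Lemma near_eq_continuous {T U : topologicalType} (f g : T -> U) (x : T) :
  (\near x, f x = g x) -> {for x, continuous f} -> {for x, continuous g}.
Proof.
move=> fg; rewrite /prop_for /continuous_at -(nbhs_singleton fg).
by apply: cvg_trans; exact: near_eq_cvg.
Qed.

Lemma continuous_coordE {R : realType} {T : topologicalType} {n : nat}
    (f : T -> 'rV[R]_n) (i : 'I_n) (x : T) :
  {for x, continuous f} -> {for x, continuous (fun y => f y 0 i)}.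
Proof.
move=> cf; apply: (@continuous_comp _ _ _ f (fun M : 'rV[R]_n => M 0 i)) => //.
exact: coord_continuous.
Qed.

Lemma continuous_sum {R : realType} {T : topologicalType} {n : nat}
    (f : 'I_n -> T -> R) (x : T) :
  (forall i, {for x, continuous (f i)}) ->
  {for x, continuous (fun y => \sum_i f i y)}.
Proof.
move=> cf; apply: cvg_big => [|i _]; first exact: add_continuous.
exact: cf.
Qed.

(** * The height function and the inverse Jacobian matrix *)

Definition height {R : realType} {m : nat} (Psi : 'rV[R]_m.+1 -> 'rV[R]_m.+1)
  (p : 'rV[R]_m.+1) : R := Psi p 0 ord_max.

Section diffeo.
Context {R : realType} {m : nat} {eps : R}.
Context {Phi Psi : 'rV[R]_m.+1 -> 'rV[R]_m.+1} {Omega : set 'rV[R]_m.+1}.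
Hypotheses (OmegaE : Omega = Phi @` (Dom eps)) (oOmega : open Omega).
Hypotheses (C2Phi : C2on (Dom eps) Phi) (C2Psi : C2on Omega Psi).
Hypothesis PhiK : forall q, Dom eps q -> Psi (Phi q) = q.
Hypothesis PsiK : forall p, Omega p -> Phi (Psi p) = p.
Hypothesis jac_gt0 : forall q, Dom eps q -> 0 < \det (jac Phi q).

Local Notation T := (height Psi).

Lemma open_Dom : open (@Dom R m eps).
Proof.
have -> : @Dom R m eps = (fun q : 'rV[R]_m.+1 => q 0 ord_max) @^-1` [set x | `|x| < eps].
  by [].
apply: open_comp.
  by move=> q _; apply: coord_continuous.
exact: open_lt_norm.
Qed.

Lemma Omega_Phi q : Dom eps q -> Omega (Phi q).
Proof. by move=> Dq; rewrite OmegaE; exists q. Qed.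

Lemma Dom_Psi p : Omega p -> Dom eps (Psi p).
Proof. by rewrite OmegaE => -[q Dq <-]; rewrite PhiK. Qed.

Lemma height_differentiable p : Omega p -> differentiable T p.
Proof. by move=> Op; apply: differentiable_coordE; exact: C2Psi.1. Qed.

Lemma pd_height p i : Omega p -> pd T i p = pd Psi i p 0 ord_max.
Proof. by move=> Op; rewrite /height pd_coord//; exact: C2Psi.1. Qed.

Lemma pd_height_differentiable p i : Omega p -> differentiable (pd T i) p.
Proof.
(* The coordinate formula for [pd T i] is known only on [Omega], whose openness makes it valid near
   [p]. *)
move=> Op; apply: (@near_eq_differentiable _ _ _ (fun y => pd Psi i y 0 ord_max)).
  by apply: (near_open oOmega Op) => y Oy; rewrite pd_height.
by apply: differentiable_coordE; exact: C2Psi.2.1.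
Qed.

Lemma pd2_height p i j : Omega p -> pd (pd T i) j p = pd (pd Psi i) j p 0 ord_max.
Proof.
move=> Op; rewrite -(pd_coord j ord_max (C2Psi.2.1 i p Op)).
by apply: near_eq_derive; apply: (near_open oOmega Op) => y Oy; rewrite pd_height.
Qed.

Lemma pd2_height_continuous p i j : Omega p -> {for p, continuous (pd (pd T i) j)}.
Proof.
move=> Op; apply: (@near_eq_continuous _ _
    (fun y : 'rV[R]_m.+1 => pd (pd Psi i) j y 0 ord_max)).
  by apply: (near_open oOmega Op) => y Oy; rewrite pd2_height.
apply: (@continuous_coordE R 'rV[R]_m.+1 m.+1 (pd (pd Psi i) j)).
by have := C2Psi.2.2 i j; rewrite continuous_open_subspace// => /(_ p (mem_set Op)).
Qed.

(** Chain rule for [Psi \o Phi], which is the identity near [q] because [Dom eps] is open. *)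
Lemma jac_inverse q : Dom eps q -> jac Psi (Phi q) *m jac Phi q = 1%:M.
Proof.
move=> Dq; have Op := Omega_Phi Dq; apply/matrixP => i j; rewrite !mxE.
transitivity (pd (Psi \o Phi) j q 0 i).
  rewrite pd_comp; [|exact: C2Phi.1|exact: C2Psi.1].
  by rewrite summxE; apply: eq_bigr => k _; rewrite !mxE mulrC.
rewrite /pd (@near_eq_derive _ _ _ _ id); last exact: (near_open open_Dom Dq).
by rewrite derive_id mxE eqxx.
Qed.

Lemma grad_height p : Omega p -> grad T p = row ord_max (jac Psi p).
Proof. by move=> Op; apply/rowP => i; rewrite !mxE pd_height. Qed.

(** The coefficients of [nvec] are the cofactors of the last Jacobian column, whose 0-based index
    [m] accounts for the sign [(-1) ^+ m]. *)
Lemma nvecE q : Dom eps q -> nvec Phi q = \det (jac Phi q) *: grad T (Phi q).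
Proof.
move=> Dq; rewrite grad_height; last exact: Omega_Phi.
rewrite -(row_adj _ (jac_inverse Dq)); apply/rowP => k; rewrite !mxE /cofactor.
rewrite -exprD addnC; congr (_ * \det _).
by apply/matrixP => a b; rewrite !mxE.
Qed.

(** A row of an invertible matrix cannot vanish. *)
Lemma grad_height_neq0 p : Omega p -> grad T p != 0.
Proof.
rewrite OmegaE => -[q Dq <-]; rewrite grad_height; last exact: Omega_Phi.
apply/eqP => g0; have := jac_inverse Dq => /(congr1 (row ord_max)).
rewrite row_mul g0 mul0mx => /rowP/(_ ord_max); rewrite !mxE eqxx => /eqP.
by rewrite eq_sym oner_eq0.
Qed.

(** Since the Jacobian determinant is positive, it leaves the norm of [nvec] without absolute value
    and cancels. *)
Lemma vphiE q : Dom eps q -> vphi Phi q = (enorm (grad T (Phi q)))^-1.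
Proof.
move=> Dq; rewrite /vphi nvecE// enormZ ?ltW ?jac_gt0// invfM mulrA divff ?mul1r//.
by rewrite gt_eqF ?jac_gt0.
Qed.

Lemma NvecE q : Dom eps q -> Nvec Phi q = vphi Phi q *: grad T (Phi q).
Proof.
move=> Dq; rewrite /Nvec {2}nvecE// scalerA mulrC -/(vphi Phi q).
by [].
Qed.

(** * Fundamental forms, mean curvature and the derivative of phi along N *)

Lemma xjacE q : xjac Phi q = col' ord_max (jac Phi q).
Proof. by apply/matrixP => a b; rewrite !mxE. Qed.

Lemma ffundE q : ffund Phi q = (xjac Phi q)^T *m xjac Phi q.
Proof.
by apply/matrixP => a b; rewrite !mxE; apply: eq_bigr => k _; rewrite !mxE.
Qed.

Lemma grad_tangent q (i : 'I_m) : Dom eps q ->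
  \sum_k pd T k (Phi q) * pd Phi (lift ord_max i) q 0 k = 0.
Proof.
move=> Dq; have /matrixP/(_ ord_max (lift ord_max i)) := jac_inverse Dq.
rewrite !mxE (negbTE (neq_lift _ _)) mulr0n => H; rewrite -[RHS]H; apply: eq_bigr => k _.
by rewrite !mxE pd_height//; exact: Omega_Phi.
Qed.

(** The product rule applied to [grad_tangent] trades [grad T] paired with second derivatives of
    [Phi] for minus the Hessian of [T] on tangent vectors; the factor [vphi] comes from [NvecE]. *)
Lemma sfundE q : Dom eps q ->
  sfund Phi q = - vphi Phi q *: ((xjac Phi q)^T *m hess T (Phi q) *m xjac Phi q).
Proof.
move=> Dq; have Op := Omega_Phi Dq; apply/matrixP => i j.
have D1 k : 'D_(delta_mx 0 (lift ord_max j)) (pd T k \o Phi) q =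
    \sum_l pd Phi (lift ord_max j) q 0 l *: pd (pd T k) l (Phi q).
  by apply: pd_comp; [exact: C2Phi.1|exact: pd_height_differentiable].
have D2 k : 'D_(delta_mx 0 (lift ord_max j)) (fun y => pd Phi (lift ord_max i) y 0 k) q =
    pd (pd Phi (lift ord_max i)) (lift ord_max j) q 0 k.
  by apply: pd_coord; exact: C2Phi.2.1.
have dG k : differentiable (pd T k \o Phi) q.
  apply: differentiable_comp; first exact: C2Phi.1.
  exact: pd_height_differentiable.
have dX k : differentiable (fun y => pd Phi (lift ord_max i) y 0 k) q.
  by apply: differentiable_coordE; exact: C2Phi.2.1.
have : pd (\sum_k (pd T k \o Phi) * (fun y => pd Phi (lift ord_max i) y 0 k))
    (lift ord_max j) q = 0.
  rewrite /pd (@near_eq_derive _ _ _ _ (cst 0)) ?derive_cst//.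
  apply: (near_open open_Dom Dq) => y Dy; rewrite fct_sumE -[RHS](grad_tangent i Dy).
  by apply: eq_bigr.
rewrite {1}/pd derive_sum; last by move=> k; apply: derivableM; exact: diff_derivable.
under eq_bigr => k _.
  rewrite deriveM; [|exact: diff_derivable|exact: diff_derivable].
  rewrite D1 D2.
  over.
rewrite /= big_split/= => /eqP; rewrite addr_eq0 => /eqP H.
rewrite !mxE NvecE// dotvC dotvZl dotvC mulNr -mulrN; congr (_ * _).
transitivity (\sum_(k < m.+1) pd T k (Phi q) *:
    pd (pd Phi (lift ord_max i)) (lift ord_max j) q 0 k).
  by apply: eq_bigr => k _; rewrite !mxE mulrC.
rewrite H; congr (- _).
under eq_bigr do rewrite scaler_sumr; rewrite exchange_big/=.
apply: eq_bigr => l _; rewrite !mxE mulr_suml; apply: eq_bigr => k _; rewrite !mxE.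
by rewrite -mulrA; congr (_ * _); rewrite mulrC.
Qed.

(** On [Omega], phi is [g \o S] with [S] the squared norm of the gradient and [g] the power -1/2, so
    that [g' = - g^3 / 2]; the 2 from differentiating the square cancels the half. *)
Lemma derive_vphi q v : Dom eps q ->
  derive (fun p => vphi Phi (Psi p)) (Phi q) v =
  - vphi Phi q ^+ 3 * (grad T (Phi q) *m hess T (Phi q) *m v^T) 0 0.
Proof.
move=> Dq; have Op := Omega_Phi Dq.
pose S : 'rV[R]_m.+1 -> R := \sum_k (pd T k) ^+ 2.
have SE p : S p = dotv (grad T p) (grad T p).
  by rewrite /S fct_sumE; apply: eq_bigr => k _; rewrite !mxE -expr2.
have S_gt0 : 0 < S (Phi q) by rewrite SE dotv_gt0// grad_height_neq0.
have dS : differentiable S (Phi q).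
  by apply: differentiable_sum => k; apply: differentiableX;
    exact: pd_height_differentiable.
have DS : 'D_v S (Phi q) = 2 * (grad T (Phi q) *m hess T (Phi q) *m v^T) 0 0.
  have dG k : derivable (pd T k) (Phi q) v.
    by apply: diff_derivable; exact: pd_height_differentiable.
  rewrite /S derive_sum; last by move=> k; exact: derivableX.
  rewrite -mulmxA mxE mulr_sumr; apply: eq_bigr => k _.
  rewrite deriveX// expr1 derive_pd; last exact: pd_height_differentiable.
  rewrite !mxE -mulr_natl !scaler_sumr !mulr_sumr; apply: eq_bigr => l _.
  by rewrite !mxE /GRing.scale/=; ring.
pose g (s : R) := (Num.sqrt s)^-1.
have dg : is_derive (S (Phi q)) 1 g (- (2^-1 * (g (S (Phi q))) ^+ 3)).
  have r0 : Num.sqrt (S (Phi q)) != 0 by rewrite gt_eqF// sqrtr_gt0.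
  have dr := is_derive1_sqrt S_gt0.
  apply: DeriveDef; first by apply: derivableV.
  rewrite deriveV//; rewrite derive_val /g; set r := Num.sqrt _ in r0 *.
  by rewrite -[LHS]/(- (r ^- 2) * (2 * r)^-1); field.
rewrite (@near_eq_derive _ _ _ _ (g \o S)); last first.
  apply: (near_open oOmega Op) => p Op'.
  by rewrite vphiE ?PsiK//; [rewrite /= SE|exact: Dom_Psi].
rewrite derive_comp1// derive_val DS vphiE// /g SE -/(enorm _).
set a := (enorm _)^-1; set b := (_ *m _) 0 0.
by field.
Qed.

Lemma dphi_dsE q : Dom eps q ->
  dphi_ds Phi Psi q =
  - vphi Phi q ^+ 2 * (Nvec Phi q *m hess T (Phi q) *m (Nvec Phi q)^T) 0 0.
Proof.
move=> Dq; rewrite /dphi_ds derive_vphi// {2}NvecE// -!scalemxAl [in RHS]mxE.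
by rewrite exprSr; ring.
Qed.

Lemma Nvec_unit q : Dom eps q -> Nvec Phi q *m (Nvec Phi q)^T = 1%:M.
Proof.
move=> Dq; have G0 := dotv_gt0 (grad_height_neq0 (Omega_Phi Dq)).
rewrite dotvE NvecE// dotvZl dotvC dotvZl mulrA -expr2 vphiE// exprVn.
by rewrite sqr_sqrtr ?ltW// mulVf// gt_eqF.
Qed.

(** This is [trace_compression] with the last column deleted: the remaining columns are tangent to
    the hypersurface, and [Nvec] is a unit multiple of the last row of the inverse Jacobian. *)
Lemma mean_curvatureE q : Dom eps q -> m%:R * meanH Phi q =
  - vphi Phi q * (\tr (hess T (Phi q)) -
    (Nvec Phi q *m hess T (Phi q) *m (Nvec Phi q)^T) 0 0).
Proof.
move=> Dq; have Op := Omega_Phi Dq; rewrite /meanH.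
have -> : m%:R * (m%:R^-1 * \tr (invmx (ffund Phi q) *m sfund Phi q)) =
    \tr (invmx (ffund Phi q) *m sfund Phi q).
  (* For [m = 0] the factor [m^-1] is 0, but so is the trace. *)
  have [m0|m0] := eqVneq m 0%N; last by rewrite mulVKf// pnatr_eq0.
  rewrite /mxtrace big1 ?mulr0// => i _.
  by have := ltn_ord i; rewrite [X in (_ < X)%N]m0.
rewrite sfundE// -scalemxAr linearZ/= ffundE xjacE; congr (_ * _).
apply: (@trace_compression _ _ _ (jac Psi (Phi q)) _ _ (vphi Phi q)).
- exact: jac_inverse.
- by rewrite NvecE// grad_height.
- exact: Nvec_unit.
Qed.

(** The normal second derivative of [T] enters [dphi_ds] and the curvature term with opposite signs
    and cancels, leaving the full trace. *)
Lemma Kq_laplacian q : Dom eps q ->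
  Kq Phi Psi q = - vphi Phi q ^+ 2 * \tr (hess T (Phi q)).
Proof. by move=> Dq; rewrite /Kq dphi_dsE// mean_curvatureE//; ring. Qed.

Lemma Kq_height q : Dom eps q ->
  Kq Phi Psi q = - (dotv (grad T (Phi q)) (grad T (Phi q)))^-1 * \tr (hess T (Phi q)).
Proof.
move=> Dq; rewrite Kq_laplacian// vphiE// exprVn sqr_sqrtr ?dotv_ge0//.
Qed.

Lemma height_lt p : Omega p -> `|T p| < eps.
Proof. by move=> /Dom_Psi. Qed.

Lemma Gam_height t : `|t| < eps -> Gam eps Phi t = [set p | Omega p /\ T p = t].
Proof.
move=> te; apply/seteqP; split => [_ [q [Dq qt] <-]|p [Op Tp]].
  by split; [exact: Omega_Phi|rewrite /height PhiK].
by exists (Psi p); [split => //; exact: Dom_Psi|exact: PsiK].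
Qed.

(** * Derivatives and Laplacian of a function of the height *)

Section function_of_height.
Context {U : 'rV[R]_m.+1 -> R} {c c1 c2 : R -> R}.
Hypothesis UE : forall p, Omega p -> U p = c (T p).
Hypothesis dc : forall t, `|t| < eps -> is_derive (t : R) 1 c (c1 t).
Hypothesis dc1 : forall t, `|t| < eps -> is_derive (t : R) 1 c1 (c2 t).

(** A generic pair [f], [f'] is used here and in [pd_height_comp] so that both apply to [c] with
    [c1] and to [c1] with [c2]. *)
Let height_comp_differentiable (f f' : R -> R) p : Omega p ->
  (forall t, `|t| < eps -> is_derive (t : R) 1 f (f' t)) -> differentiable (f \o T) p.
Proof.
move=> Op df; apply: differentiable_comp; first exact: height_differentiable.
by apply/derivable1_diffP; have [] := df _ (height_lt Op).
Qed.

Let pd_height_comp (f f' : R -> R) p i : Omega p ->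
  (forall t, `|t| < eps -> is_derive (t : R) 1 f (f' t)) ->
  pd (f \o T) i p = f' (T p) * pd T i p.
Proof.
move=> Op df; have dfT := df _ (height_lt Op).
rewrite /pd derive_comp1//; last exact: height_differentiable.
by rewrite derive_val.
Qed.

Let near_UE p : Omega p -> \near p, (c \o T) p = U p.
Proof. by move=> Op; apply: (near_open oOmega Op) => y /UE ->. Qed.

Lemma differentiable_function_of_height p : Omega p -> differentiable U p.
Proof.
move=> Op; apply: near_eq_differentiable (near_UE Op) _.
exact: height_comp_differentiable dc.
Qed.

Lemma pd_function_of_height p i : Omega p -> pd U i p = c1 (T p) * pd T i p.
Proof.
move=> Op; rewrite -(pd_height_comp i Op dc); apply/esym/near_eq_derive.
exact: near_UE.
Qed.

Let near_pdU p i : Omega p -> \near p, ((c1 \o T) * pd T i) p = pd U i p.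
Proof.
by move=> Op; apply: (near_open oOmega Op) => y Oy; rewrite pd_function_of_height.
Qed.

Lemma pd_differentiable_function_of_height p i :
  Omega p -> differentiable (pd U i) p.
Proof.
move=> Op; apply: near_eq_differentiable (near_pdU i Op) _.
apply: differentiableM; first exact: height_comp_differentiable dc1.
exact: pd_height_differentiable.
Qed.

Lemma pd2_function_of_height p i j : Omega p ->
  pd (pd U i) j p =
  c2 (T p) * pd T i p * pd T j p + c1 (T p) * pd (pd T i) j p.
Proof.
move=> Op; transitivity (pd ((c1 \o T) * pd T i) j p).
  by apply/esym/near_eq_derive; exact: near_pdU.
rewrite {1}/pd deriveM; last 2 first.
- by apply: diff_derivable; exact: height_comp_differentiable dc1.
- by apply: diff_derivable; exact: pd_height_differentiable.
have := pd_height_comp j Op dc1; rewrite {1}/pd => ->.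
by rewrite /GRing.scale/= addrC -/(pd _ _ _); congr (_ + _); ring.
Qed.

Lemma laplacian_function_of_height q : Dom eps q ->
  \sum_i pd (pd U i) i (Phi q) = dotv (grad T (Phi q)) (grad T (Phi q)) *
    (c2 (q 0 ord_max) - c1 (q 0 ord_max) * Kq Phi Psi q).
Proof.
move=> Dq; have Op := Omega_Phi Dq; rewrite Kq_height//.
have S0 : dotv (grad T (Phi q)) (grad T (Phi q)) != 0.
  by rewrite gt_eqF// dotv_gt0// grad_height_neq0.
have KS (S a b L : R) : S != 0 -> S * (a - b * (- S^-1 * L)) = a * S + b * L.
  by move=> ?; field.
rewrite KS//.
have Tq : T (Phi q) = q 0 ord_max by rewrite /height PhiK.
rewrite -Tq !mulr_sumr -big_split/=; apply: eq_bigr => i _.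
by rewrite pd2_function_of_height// !mxE; ring.
Qed.

Lemma C2_function_of_height :
  (forall t, `|t| < eps -> {for t, continuous c2}) -> C2on Omega U.
Proof.
move=> cc2; split; first exact: differentiable_function_of_height.
split; first by move=> i x; exact: pd_differentiable_function_of_height.
move=> i j; rewrite continuous_open_subspace// => p /set_mem Op.
have cT : {for p, continuous T}.
  by apply: differentiable_continuous; exact: height_differentiable.
have cG k : {for p, continuous (pd T k)}.
  by apply: differentiable_continuous; exact: pd_height_differentiable.
apply: (@near_eq_continuous _ _
    (fun p => c2 (T p) * pd T i p * pd T j p + c1 (T p) * pd (pd T i) j p)).
  by apply: (near_open oOmega Op) => y Oy; rewrite pd2_function_of_height.
have cc1T : {for p, continuous (fun p => c1 (T p))}.
  apply: differentiable_continuous; exact: height_comp_differentiable dc1.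
have cc2T : {for p, continuous (fun p => c2 (T p))}.
  by apply: continuous_comp => //; apply: cc2; exact: height_lt.
apply: continuousD; last by apply: continuousM => //; exact: pd2_height_continuous.
by apply: continuousM => //; exact: continuousM.
Qed.

End function_of_height.

(** * The two implications, by restriction to a transversal axis *)

Lemma is_derive_line {V : normedModType R}
    (f : 'rV[R]_m.+1 -> V) (v : 'rV[R]_m.+1) (t : R) :
  differentiable f (t *: v) ->
  is_derive (t : R) 1 (fun s : R => f (s *: v)) ('D_v f (t *: v)).
Proof.
move=> df; pose l (s : R) : 'rV[R]_m.+1 := s *: v.
have dl : is_diff t l ( *:%R^~ v) by exact: is_diff_scalel.
have dl' : differentiable l t by have [] := dl.
have dfl : differentiable (f \o l) t by exact: differentiable_comp.
have -> : 'D_v f (t *: v) = 'D_1 (f \o l) t.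
  rewrite (deriveE _ dfl) (deriveE _ df) (diff_comp dl' df).
  by rewrite /= diff_val scale1r.
exact/derivableP/derivable1_diffP.
Qed.

(** The point with x = 0 and parameter [t]: one representative for each hypersurface of the
    family. *)
Let axis (t : R) : 'rV[R]_m.+1 := t *: 'e_ord_max.

Let axis_last t : axis t 0 ord_max = t.
Proof. by rewrite !mxE !eqxx mulr1. Qed.

Let Dom_axis t : `|t| < eps -> Dom eps (axis t).
Proof. by rewrite /Dom/= axis_last. Qed.

Lemma harmonic_constant_K (U : 'rV[R]_m.+1 -> R) :
  C2on Omega U ->
  (forall p, Omega p -> \sum_i pd (pd U i) i p = 0) ->
  (forall p, Omega p -> exists i, pd U i p != 0) ->
  (forall t, `|t| < eps -> exists c, Gam eps Phi t = [set p | Omega p /\ U p = c]) ->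
  forall q q', Dom eps q -> Dom eps q' -> q 0 ord_max = q' 0 ord_max ->
  Kq Phi Psi q = Kq Phi Psi q'.
Proof.
move=> C2U harm crit level.
(* Sampling [U] on the axis produces [c]; [f1] is the t-derivative of [U \o Phi], so [c1] is the
   derivative of [c]. *)
pose c t := U (Phi (axis t)).
pose f1 q := \sum_i pd Phi ord_max q 0 i *: pd U i (Phi q).
pose c1 t := f1 (axis t).
(* [p] and the axis point of the same height lie on one hypersurface, where [U] is constant. *)
have UE p : Omega p -> U p = c (height Psi p).
  move=> Op; have te := height_lt Op; have [a aE] := level _ te.
  have : Gam eps Phi (height Psi p) p by rewrite Gam_height.
  rewrite aE => -[_ ->].
  have : Gam eps Phi (height Psi p) (Phi (axis (height Psi p))).
    exists (axis (height Psi p)) => //; split; first exact: Dom_axis.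
    exact: axis_last.
  by rewrite aE => -[_ /esym].
have dc t : `|t| < eps -> is_derive (t : R) 1 c (c1 t).
  move=> te; have Da := Dom_axis te.
  have dPhi := C2Phi.1 _ Da; have dU := C2U.1 _ (Omega_Phi Da).
  rewrite /c1 /f1 -(pd_comp ord_max dPhi dU).
  apply: (@is_derive_line _ (U \o Phi)).
  exact: differentiable_comp.
have df1 q : Dom eps q -> differentiable f1 q.
  move=> Dq; have -> : f1 = \sum_i ((fun q => pd Phi ord_max q 0 i) * (pd U i \o Phi)).
    by apply/funext => y; rewrite fct_sumE.
  apply: differentiable_sum => i; apply: differentiableM.
    by apply: differentiable_coordE; exact: C2Phi.2.1.
  apply: differentiable_comp; first exact: C2Phi.1.
  by apply: C2U.2.1; exact: Omega_Phi.
have dc1 t : `|t| < eps -> is_derive (t : R) 1 c1 (pd f1 ord_max (axis t)).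
  by move=> te; apply: is_derive_line; exact/df1/Dom_axis.
suff KE q : Dom eps q -> Kq Phi Psi q =
    pd f1 ord_max (axis (q 0 ord_max)) / c1 (q 0 ord_max).
  by move=> q q' Dq Dq' qq'; rewrite !KE// qq'.
move=> Dq; have Op := Omega_Phi Dq.
(* Every partial derivative of [U] carries the factor [c1], so a zero of [c1] would be a critical
   point. *)
have c0 : c1 (q 0 ord_max) != 0.
  have [i] := crit _ Op; rewrite (pd_function_of_height UE dc)//.
  by rewrite mulf_eq0 /height PhiK// => /norP[].
have := harm _ Op; rewrite (laplacian_function_of_height UE dc dc1)//.
move=> /eqP; rewrite mulf_eq0 gt_eqF ?dotv_gt0 ?grad_height_neq0//= subr_eq0.
by move=> /eqP ->; rewrite mulrAC divff ?mul1r.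
Qed.

(** Two integrations solve [c'' = k c'] with [c' > 0]. Positivity serves twice: it excludes critical
    points and makes [c] injective, so that a level set of [U] is a single hypersurface. *)
Lemma constant_K_harmonic :
  (forall q q', Dom eps q -> Dom eps q' -> q 0 ord_max = q' 0 ord_max ->
    Kq Phi Psi q = Kq Phi Psi q') ->
  exists U : 'rV[R]_m.+1 -> R,
    C2on Omega U /\
    (forall p, Omega p -> \sum_(i < m.+1) pd (pd U i) i p = 0) /\
    (forall p, Omega p -> exists i, pd U i p != 0) /\
    (forall t, `|t| < eps ->
       exists c : R, Gam eps Phi t = [set p | Omega p /\ U p = c]).
Proof.
move=> Kconst; pose k t := Kq Phi Psi (axis t).
(* Continuity of [k], needed for integrating it, is read off [Kq_height] composed with the curve
   [Phi (axis s)]. *)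
have ck t : `|t| < eps -> {for t, continuous k}.
  move=> te; have Op := Omega_Phi (Dom_axis te).
  pose F p := - (\sum_i (pd (height Psi) i p) ^+ 2)^-1 *
    \sum_i pd (pd (height Psi) i) i p.
  have cG i : {for Phi (axis t), continuous (pd (height Psi) i)}.
    by apply: differentiable_continuous; exact: pd_height_differentiable.
  have gradE p : \sum_i (pd (height Psi) i p) ^+ 2 =
      dotv (grad (height Psi) p) (grad (height Psi) p).
    by apply: eq_bigr => i _; rewrite !mxE expr2.
  apply: (@near_eq_continuous _ _ (fun s => F (Phi (axis s)))).
    near=> s; rewrite /k Kq_height; last first.
      by apply: Dom_axis; near: s; exact: near_lt_norm.
    rewrite /F gradE; congr (_ * _).
    by apply: eq_bigr => i _; rewrite mxE.
  have cPhi : {for t, continuous (fun s => Phi (axis s))}.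
    apply: differentiable_continuous; apply/derivable1_diffP.
    have [] := @is_derive_line _ Phi 'e_ord_max t => //.
    by apply: C2Phi.1; exact: Dom_axis.
  apply: (@continuous_comp _ _ _ _ F) => //.
  apply: continuousM.
    apply: continuousN; apply: continuousV.
      by rewrite gradE gt_eqF// dotv_gt0// grad_height_neq0.
    by apply: continuous_sum => i; apply: continuousM; exact: cG.
  by apply: continuous_sum => i; exact: pd2_height_continuous.
have [A dA] := open_primitive ck.
(* The exponential of a primitive of [k] solves [c1' = k c1] and never vanishes. *)
pose c1 t := expR (A t).
pose c2 t := c1 t * k t.
have dc1 t : `|t| < eps -> is_derive (t : R) 1 c1 (c2 t).
  by move=> te; have dAt := dA _ te; exact: is_derive1_comp.
have cc1 t : `|t| < eps -> {for t, continuous c1}.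
  move=> te; apply: differentiable_continuous; apply/derivable1_diffP.
  by have [] := dc1 _ te.
have [c dc] := open_primitive cc1.
have cc2 t : `|t| < eps -> {for t, continuous c2}.
  by move=> te; apply: continuousM; [exact: cc1|exact: ck].
pose U p := c (height Psi p).
have UE p : Omega p -> U p = c (height Psi p) by [].
exists U; split; first exact: (C2_function_of_height UE dc dc1 cc2).
split.
  move=> p; rewrite OmegaE => -[q Dq <-].
  rewrite (laplacian_function_of_height UE dc dc1)// /c2 /k.
  (* The constancy assumption replaces the axis value of [Kq] by its value at [q], so [c'' - c' K]
     vanishes there. *)
  rewrite (Kconst (axis (q 0 ord_max)) q) ?axis_last//; last exact: Dom_axis.
  by rewrite subrr mulr0.
split.
  move=> p Op; have /rV0Pn[i] := grad_height_neq0 Op; rewrite mxE => Gi.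
  exists i; rewrite (pd_function_of_height UE dc)// mulf_neq0//.
  by rewrite gt_eqF ?expR_gt0.
move=> t te; exists (c t); rewrite Gam_height//; apply/seteqP.
split=> p /= [Op cpt]; split => //; first by rewrite /U cpt.
move: cpt; rewrite /U => cpt.
suff c_inj a b : `|a| < eps -> `|b| < eps -> a < b -> c a != c b.
  have [Tt|Tt|//] := ltgtP (height Psi p) t.
    by have := c_inj _ _ (height_lt Op) te Tt; rewrite cpt eqxx.
  by have := c_inj _ _ te (height_lt Op) Tt; rewrite cpt eqxx.
move=> ae be ab.
have sub z : z \in `[a, b] -> `|z| < eps.
  move: ae be; rewrite in_itv/= !ltr_norml => /andP[ae _] /andP[_ be].
  by move=> /andP[az zb]; rewrite (lt_le_trans ae az) (le_lt_trans zb be).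
(* By the mean value theorem [c b - c a] is [c1 z * (b - a)], a product of positive factors. *)
have [||z _ /eqP] := @MVT _ c c1 a b ab.
- by move=> z /subset_itv_oo_cc/sub; exact: dc.
- by apply: derivable_within_continuous => z /sub/dc[].
- rewrite -subr_eq0 => zE; rewrite eq_sym -subr_eq0; move: zE.
  by rewrite subr_eq0 => /eqP ->; rewrite mulf_neq0 ?gt_eqF ?expR_gt0 ?subr_gt0.
Unshelve. all: by end_near. Qed.

End diffeo.

Theorem theorem3 (R : realType) (m : nat) (eps : R)
  (Phi Psi : 'rV[R]_m.+1 -> 'rV[R]_m.+1) (Omega : set 'rV[R]_m.+1) :
  0 < eps ->
  Omega = Phi @` (Dom eps) ->
  open Omega ->
  C2on (Dom eps) Phi ->
  C2on Omega Psi ->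
  (forall q, Dom eps q -> Psi (Phi q) = q) ->
  (forall p, Omega p -> Phi (Psi p) = p) ->
  (forall q, Dom eps q -> 0 < \det (jac Phi q)) ->
  ((exists U : 'rV[R]_m.+1 -> R,
      C2on Omega U /\
      (forall p, Omega p -> \sum_(i < m.+1) pd (pd U i) i p = 0) /\
      (forall p, Omega p -> exists i, pd U i p != 0) /\
      (forall t, `|t| < eps ->
         exists c : R, Gam eps Phi t = [set p | Omega p /\ U p = c]))
   <->
   (forall q q', Dom eps q -> Dom eps q' -> q 0 ord_max = q' 0 ord_max ->
      Kq Phi Psi q = Kq Phi Psi q')).
Proof.
move=> _ OmegaE oOmega C2Phi C2Psi PhiK PsiK jac_gt0; split.
  move=> [U [C2U [harm [crit level]]]].
  exact: (harmonic_constant_K OmegaE oOmega C2Phi C2Psi PhiK PsiK jac_gt0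
    C2U harm crit level).
exact: (constant_K_harmonic OmegaE oOmega C2Phi C2Psi PhiK PsiK jac_gt0).
Qed.
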